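(* Let $\beta\in\mathbb{C}$, $\beta\neq0$, satisfy $\Delta(\beta)\neq0$, and let $\alpha_1\ne\alpha_2$ be the two (nonzero) complex numbers with $\mathbf{p}(\beta,\alpha_1)=\mathbf{p}(\beta,\alpha_2)=1$. Then the function $$h_\beta(y)=C(\beta,\alpha_2)\,\beta^{y(1)-y(2)}\alpha_1^{y(2)}-C(\beta,\alpha_1)\,\beta^{y(1)-y(2)}\alpha_2^{y(2)}$$ is $Y$-harmonic.
   Context: Let $\lambda,\mu_1,\mu_2>0$ with $\lambda+\mu_1+\mu_2=1$, $\lambda<\mu_1$, $\lambda<\mu_2$, $\mu_1\ne\mu_2$. $Y$ is the constrained random walk on $\mathbb{Z}\times\mathbb{Z}_+$: $Y_{k+1}=Y_k+\pi_1(Y_k,J_k)$, where the $J_k$ are i.i.d. with $P(J_k=(-1,0))=\lambda$, $P(J_k=(1,1))=\mu_1$, $P(J_k=(0,-1))=\mu_2$, and $\pi_1(y,v)=v$ if $y+v\in\mathbb{Z}\times\mathbb{Z}_+$, $0$ otherwise. With $B=\{y\in\mathbb{Z}\times\mathbb{Z}_+:y(1)\ge y(2)\}$, a function $V$ is $Y$-harmonic if $V(y)=\mathbb{E}_y[V(Y_1)]$ for $y\in B$. $\mathbf{p}(\beta,\alpha)=\lambda\frac1\beta+\mu_1\alpha+\mu_2\frac{\beta}{\alpha}$, $\Delta(\beta)=\left(\frac\lambda\beta-1\right)^2-4\mu_1\mu_2\beta$ (the discriminant of $\alpha\mathbf{p}(\beta,\alpha)=\alpha$ as a quadratic equation in $\alpha$),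 and $C(\beta,\alpha)=\mu_2\left(1-\frac\beta\alpha\right)$. *)

(* Defs.v *)
From HB Require Import structures.
From mathcomp Require Import all_boot all_order all_algebra.
From mathcomp Require Import all_classical all_reals all_analysis.
From mathcomp Require Import complex.

Set Implicit Arguments.
Unset Strict Implicit.
Unset Printing Implicit Defensive.

Import Order.TTheory GRing.Theory Num.Theory.
Import numFieldNormedType.Exports.

Local Open Scope classical_set_scope.
Local Open Scope ring_scope.
Local Open Scope complex_scope.

(* The library equips nat and bool, but not int, with the discrete
   sigma-algebra; int * int then carries the product one, which is again
   discrete. *)
HB.instance Definition _ := isPointed.Build int 0.

HB.instance Definition _ := @isMeasurable.Build default_measure_display
  int discrete_measurable discrete_measurable0
  discrete_measurableC discrete_measurableU.

Notation site := (int * int)%type.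

Section Walk.

Variables (R : realType) (d : measure_display) (Omega : measurableType d).
Variable P : probability Omega R.

Definition mutually_independent (J : nat -> {RV P >-> site}) : Prop :=
  forall (s : seq nat) (A : nat -> set site), uniq s ->
    (forall k, measurable (A k)) ->
    P (\bigcap_(k in [set` s]) (J k @^-1` A k)) =
    (\prod_(k <- s) P (J k @^-1` A k))%E.

(* When lambda + mu1 + mu2 = 1, the three atoms exhaust the law. *)
Definition has_step_law (lambda mu1 mu2 : R) (X : {RV P >-> site}) : Prop :=
  [/\ P [set w | X w = (- 1, 0)] = lambda%:E,
      P [set w | X w = (1, 1)] = mu1%:E &
      P [set w | X w = (0, - 1)] = mu2%:E].

Definition iid_steps (lambda mu1 mu2 : R) (J : nat -> {RV P >-> site}) : Prop :=
  mutually_independent J /\ forall k, has_step_law lambda mu1 mu2 (J k).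

Definition half_plane (y : site) : bool := 0 <= y.2.

Definition B : set site := [set y | half_plane y /\ y.2 <= y.1].

Definition pi1 (y v : site) : site :=
  if half_plane (y + v) then v else 0.

Fixpoint Y (J : nat -> {RV P >-> site}) (y : site) (k : nat) (w : Omega)
    : site :=
  if k is k'.+1 then Y J y k' w + pi1 (Y J y k' w) (J k' w) else y.

(* The library's expectation is extended-real valued, so these equations also
   say that both parts of X have a finite expectation. *)
Definition is_expectation (X : Omega -> R[i]) (z : R[i]) : Prop :=
  'E_P[(fun w => complex.Re (X w))]%E = (complex.Re z)%:E /\
  'E_P[(fun w => complex.Im (X w))]%E = (complex.Im z)%:E.

Definition Y_harmonic (J : nat -> {RV P >-> site}) (V : site -> R[i]) : Prop :=
  forall y, B y -> is_expectation (fun w => V (Y J y 1 w)) (V y).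

End Walk.

Arguments iid_steps {R d Omega} P lambda mu1 mu2 J.
Arguments Y_harmonic {R d Omega} P J V.

Section Characteristic.

Variables (R : realType) (lambda mu1 mu2 : R).

Definition p (beta alpha : R[i]) : R[i] :=
  lambda%:C * beta^-1 + mu1%:C * alpha + mu2%:C * (beta / alpha).

Definition Delta (beta : R[i]) : R[i] :=
  (lambda%:C / beta - 1) ^+ 2 - 4 * mu1%:C * mu2%:C * beta.

Definition C (beta alpha : R[i]) : R[i] := mu2%:C * (1 - beta / alpha).

(* Integer powers: the exponent y.1 - y.2 is negative outside B. *)
Definition h (beta alpha1 alpha2 : R[i]) (y : site) : R[i] :=
  C beta alpha2 * beta ^ (y.1 - y.2) * alpha1 ^ y.2 -
  C beta alpha1 * beta ^ (y.1 - y.2) * alpha2 ^ y.2.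

End Characteristic.

(* Main.v *)
Require Import Defs.
From HB Require Import structures.
From mathcomp Require Import all_boot all_order all_algebra.
From mathcomp Require Import all_classical all_reals all_analysis.
From mathcomp Require Import measurable_realfun complex.
From mathcomp Require Import ring.

(** The expectation of a function of one step is the sum of its values at the
    three jumps weighted by [lambda], [mu1] and [mu2], because the rates add up
    to 1 and so every other value of the step has probability zero
    ([is_expectation_step_law]).  Harmonicity thus becomes an algebraic identity
    at each site [y] of [B], about the monomials
    [beta ^ (y.1 - y.2) * alpha ^ y.2] of which [h] is a combination.

    These monomials are characters of the group of sites, so averaging one of
    them over the three jumps multiplies it by a constant, which is
    [p beta alpha] ([monomial_sum]).  Since [p beta alpha1] and
    [p beta alpha2] are both 1, each monomial is separately harmonic where no
    jump is blocked, that is where [0 < y.2].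

    On the axis [y.2 = 0] the jump [(0, - 1)] is replaced by staying put, which
    changes the factor into [p beta alpha + C beta alpha]
    ([monomial_sum_axis]); neither monomial need be harmonic there.  But both
    take the same value on the axis, so with [Ci] for [C beta alphai] the
    coefficients of [h] make the defects cancel:
    [C2 * (1 + C1) - C1 * (1 + C2) = C2 - C1]. *)

Set Implicit Arguments.
Unset Strict Implicit.

Import Order.TTheory GRing.Theory Num.Theory.
Import numFieldNormedType.Exports.

Local Open Scope classical_set_scope.
Local Open Scope ring_scope.
Local Open Scope complex_scope.

(** * Expectation over one step *)

Lemma measurable_site (A : set site) : measurable A.
Proof.
apply: countable_measurable; last exact: countableP.
move=> [i j].
have -> : [set (i, j)] = ([set i] `*` [set j]) :> set site.
  by apply/seteqP; split=> [[a b] [-> ->]|[a b] [/= -> ->]].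
exact: measurableX.
Qed.

(** Almost surely [X] falls in [s], and there [g (X w)] is the finite linear
    combination of the indicators of the events [X = v], which is integrated
    term by term. *)
Lemma expectation_finite_support (R : realType) (d d' : measure_display)
    (Omega : measurableType d) (T : measurableType d')
    (P : probability Omega R) (X : {RV P >-> T}) (s : seq T) (g : T -> R) :
    (forall A : set T, measurable A) -> uniq s ->
    (\sum_(v <- s) P [set w | X w = v] = 1)%E ->
  ('E_P[fun w => g (X w)] = \sum_(v <- s) (g v)%:E * P [set w | X w = v])%E.
Proof.
move=> mT us sP1.
pose F v : set Omega := [set w | X w = v].
have mF v : measurable (F v).
  rewrite -[F v]setTI.
  exact: (@measurable_funPT _ _ _ _ X measurableT _ (mT [set v])).
have fs : finite_set [set` s] by exact: finite_seq.
pose A : set Omega := (\bigcup_(v in [set` s]) F v).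
have mA : measurable A by apply: fin_bigcup_measurable.
have PA : P A = 1%E.
  rewrite measure_fin_bigcup//.
    by rewrite -fsbig_seq.
  by move=> i j _ _ [w [/= <- <-]].
have aeA : {ae P, forall w, A w}.
  exists (~` A); split=> //; first exact: measurableC.
  by rewrite probability_setC// PA subee.
pose k (w : Omega) : \bar R := (\sum_(v <- s) (g v)%:E * (\1_(F v) w)%:E)%E.
have mk : measurable_fun setT k.
  apply: emeasurable_sum => v _.
  apply: measurable_funeM => //; apply/measurable_EFinP.
  exact: measurable_indic.
rewrite expectation.unlock; transitivity (\int[P]_w k w)%E; last first.
  rewrite integral_sum//; last first.
    by move=> v; apply: integrableZl => //; exact: integrable_indic.
  apply: eq_bigr => v _.
  rewrite integralZl//; last exact: integrable_indic.
  by rewrite integral_indic// setIT.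
apply: ae_eq_integral => //.
  apply/measurable_EFinP; apply: (measurableT_comp (f := g)).
    by move=> _ B _; exact: mT.
  exact: measurable_funPT.
apply: filterS aeA => w [v vs Xv] _.
have {vs Xv} Xs : X w \in s by rewrite Xv.
rewrite /k (bigD1_seq (X w))//= big1 ?adde0.
  by rewrite indicE mem_set// mule1.
move=> u /eqP uX; rewrite indicE memNset ?mule0//.
by move=> /esym.
Qed.

Lemma is_expectation_step_law (R : realType) (d : measure_display)
    (Omega : measurableType d) (P : probability Omega R)
    (lambda mu1 mu2 : R) (X : {RV P >-> site}) (g : site -> R[i]) :
    lambda + mu1 + mu2 = 1 -> has_step_law lambda mu1 mu2 X ->
  is_expectation P (fun w => g (X w))
    (lambda%:C * g (- 1, 0) + mu1%:C * g (1, 1) + mu2%:C * g (0, - 1)).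
Proof.
move=> sum_rates [PW PNE PS].
have real_step (f : site -> R) : ('E_P[fun w => f (X w)] =
    (lambda * f (- 1, 0)%R + mu1 * f (1, 1)%R + mu2 * f (0, - 1)%R)%:E)%E.
  rewrite (@expectation_finite_support _ _ _ _ _ _ X
            [:: (- 1, 0); (1, 1); (0, - 1)] f measurable_site)//.
    rewrite !big_cons big_nil PW PNE PS adde0 -!EFinM -!EFinD addrA.
    by congr (_%:E); ring.
  by rewrite !big_cons big_nil PW PNE PS adde0 -!EFinD addrA sum_rates.
split; [rewrite (real_step (fun v => complex.Re (g v)))
       |rewrite (real_step (fun v => complex.Im (g v)))]; congr (_%:E) => /=.
all: case: (g (- 1, 0)) (g (1, 1)) (g (0, - 1)) => [a b] [a' b'] [a'' b''] /=.
all: ring.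
Qed.

(** * The monomials under the walk *)

Definition monomial (K : fieldType) (beta alpha : K) (y : site) : K :=
  beta ^ (y.1 - y.2) * alpha ^ y.2.

Lemma h_monomialE (R : realType) (mu2 : R) (beta alpha1 alpha2 : R[i]) (y : site) :
  h mu2 beta alpha1 alpha2 y =
  C mu2 beta alpha2 * monomial beta alpha1 y -
  C mu2 beta alpha1 * monomial beta alpha2 y.
Proof. by rewrite /h /monomial !mulrA. Qed.

(** The exponents are additive in the site, so a jump multiplies a monomial by
    a factor independent of the starting point. *)
Lemma monomialD (K : fieldType) (beta alpha : K) (y v : site) :
  beta != 0 -> alpha != 0 ->
  monomial beta alpha (y + v) =
  monomial beta alpha y * monomial beta alpha v.
Proof.
move=> b0 a0; rewrite /monomial/= opprD addrACA !expfzDr//; ring.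
Qed.

Lemma monomial_increment (K : fieldType) (beta alpha : K) :
  [/\ monomial beta alpha (- 1, 0) = beta^-1,
      monomial beta alpha (1, 1) = alpha &
      monomial beta alpha (0, - 1) = beta / alpha].
Proof.
by rewrite /monomial/= subr0 subrr opprK add0r !expr0z !exprN1 mulr1 mul1r.
Qed.

Lemma monomial_sum (R : realType) (lambda mu1 mu2 : R)
    (beta alpha : R[i]) (y : site) : beta != 0 -> alpha != 0 ->
  lambda%:C * monomial beta alpha (y + (- 1, 0)) +
  mu1%:C * monomial beta alpha (y + (1, 1)) +
  mu2%:C * monomial beta alpha (y + (0, - 1)) =
  p lambda mu1 mu2 beta alpha * monomial beta alpha y.
Proof.
move=> b0 a0; rewrite !monomialD// /p.
have [-> -> ->] := monomial_increment beta alpha; ring.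
Qed.

(** The blocked jump contributes [mu2] in place of [mu2 * (beta / alpha)] to the
    factor, and the difference of the two is [C beta alpha]. *)
Lemma monomial_sum_axis (R : realType) (lambda mu1 mu2 : R)
    (beta alpha : R[i]) (y : site) : beta != 0 -> alpha != 0 ->
  lambda%:C * monomial beta alpha (y + (- 1, 0)) +
  mu1%:C * monomial beta alpha (y + (1, 1)) +
  mu2%:C * monomial beta alpha y =
  (p lambda mu1 mu2 beta alpha + C mu2 beta alpha) * monomial beta alpha y.
Proof.
move=> b0 a0; rewrite mulrDl -monomial_sum// !(monomialD y _ b0 a0) /C.
have [-> -> ->] := monomial_increment beta alpha; ring.
Qed.

Unset Implicit Arguments.

Theorem proposition3p3 (R : realType) (lambda mu1 mu2 : R)
    (lambda_gt0 : 0 < lambda) (mu1_gt0 : 0 < mu1) (mu2_gt0 : 0 < mu2)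
    (sum_rates : lambda + mu1 + mu2 = 1)
    (lambda_lt_mu1 : lambda < mu1) (lambda_lt_mu2 : lambda < mu2)
    (mu1_neq_mu2 : mu1 <> mu2)
    (d : measure_display) (Omega : measurableType d) (P : probability Omega R)
    (J : nat -> {RV P >-> site}) (J_iid : iid_steps P lambda mu1 mu2 J)
    (beta : R[i]) (beta_neq0 : beta <> 0)
    (Delta_neq0 : Delta lambda mu1 mu2 beta <> 0)
    (alpha1 alpha2 : R[i]) (alpha_neq : alpha1 <> alpha2)
    (alpha1_neq0 : alpha1 <> 0) (alpha2_neq0 : alpha2 <> 0)
    (p_alpha1 : p lambda mu1 mu2 beta alpha1 = 1)
    (p_alpha2 : p lambda mu1 mu2 beta alpha2 = 1) :
  Y_harmonic P J (h mu2 beta alpha1 alpha2).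
Proof.
move=> y [y2_ge0 _]; rewrite /half_plane in y2_ge0.
move/eqP: beta_neq0 => b0; move/eqP: alpha1_neq0 => a10.
move/eqP: alpha2_neq0 => a20.
set H := h _ _ _ _.
have := is_expectation_step_law (fun v => H (y + pi1 y v)) sum_rates
  (J_iid.2 0%N).
congr is_expectation.
have -> : pi1 y (-1, 0) = (-1, 0) by rewrite /pi1 /half_plane /= addr0 y2_ge0.
have -> : pi1 y (1, 1) = (1, 1) by rewrite /pi1 /half_plane /= addr_ge0.
rewrite /H !h_monomialE.
have [y2_gt0|y2_le0] := ltrP 0 y.2.
  have -> : pi1 y (0, -1) = (0, -1).
    by rewrite /pi1 /half_plane /= subr_ge0 -gtz0_ge1 y2_gt0.
  have M1 := monomial_sum lambda mu1 mu2 y b0 a10.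
  have M2 := monomial_sum lambda mu1 mu2 y b0 a20.
  rewrite p_alpha1 mul1r in M1; rewrite p_alpha2 mul1r in M2.
  by rewrite -[in RHS]M1 -[in RHS]M2; ring.
have -> : pi1 y (0, -1) = 0.
  by rewrite /pi1 /half_plane /= subr_ge0 -gtz0_ge1 ltNge y2_le0.
rewrite addr0.
have M1 := monomial_sum_axis lambda mu1 mu2 y b0 a10.
have M2 := monomial_sum_axis lambda mu1 mu2 y b0 a20.
rewrite p_alpha1 in M1; rewrite p_alpha2 in M2.
have y20 : y.2 = 0 by apply/eqP; rewrite eq_le y2_le0.
have E : monomial beta alpha1 y = monomial beta alpha2 y.
  by rewrite /monomial y20 !expr0z.
transitivity (
  C mu2 beta alpha2 * ((1 + C mu2 beta alpha1) * monomial beta alpha1 y) -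
  C mu2 beta alpha1 * ((1 + C mu2 beta alpha2) * monomial beta alpha2 y)).
  by rewrite -M1 -M2; ring.
rewrite E; ring.
Qed.
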